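(* For every natural number $m\geq 1$, $\mathrm{Conj}_{\mathrm{H}_{2m+1}(\mathbb{Z})}(n)\approx n^{2m+1}$.
   Context: For non-decreasing non-negative functions $f,g$ on $\mathbb{N}=\{1,2,\dots\}$, write $f\preceq g$ if there is $C\in\mathbb{N}$ with $f(n)\le C\,g(Cn)$ for all $n$, and $f\approx g$ if $f\preceq g$ and $g\preceq f$. For a finitely generated group $\Gamma$ with finite generating subset $S$ and word length $\|\cdot\|_S$, write $\gamma\sim\eta$ if $\gamma,\eta$ are conjugate. For $\gamma\nsim\eta$ put $\mathrm{CD}_\Gamma(\gamma,\eta)=\min\{|Q| : \varphi:\Gamma\to Q \text{ a surjective homomorphism to a finite group},\ \varphi(\gamma)\nsim\varphi(\eta)\}$, and $\mathrm{Conj}_{\Gamma,S}(n)=\max\{\mathrm{CD}_\Gamma(\gamma,\eta) : \gamma\nsim\eta,\ \|\gamma\|_S,\|\eta\|_S\le n\}$. Up to $\approx$ this is independent of $S$, and one writes $\mathrm{Conj}_\Gamma$. $\mathrm{H}_{2m+1}(\mathbb{Z})$ is the $(2m+1)$-dimensional integral Heisenberg group, i.e. the group of matrices $\begin{pmatrix}1&\vec{x}&z\\ \vec 0&\mathbf{I}_m&\vec y\\ 0&\vec 0&1\end{pmatrix}$ with $z\in\mathbb{Z}$ and $\vec x,\vec y^{T}\in\mathbb{Z}^m$, where $\mathbf{I}_m$ is the $m\times m$ identity matrix. *)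

(* Defs.v *)
From HB Require Import structures.
From mathcomp Require Import all_boot all_algebra all_fingroup.

Set Implicit Arguments.
Unset Strict Implicit.
Unset Printing Implicit Defensive.

Import GRing.Theory.

(* [is_min A k]: k is the minimum of the set A of natural numbers. *)
Definition is_min (A : nat -> Prop) (k : nat) : Prop :=
  A k /\ forall j, A j -> k <= j.

(* Functions are compared on {1, 2, ...}: values at 0 are irrelevant. *)
Definition growth_le (f g : nat -> nat) : Prop :=
  exists2 C, 0 < C & forall n, 0 < n -> f n <= C * g (C * n).

Definition growth_eq (f g : nat -> nat) : Prop :=
  growth_le f g /\ growth_le g f.

Section Groups.
Local Open Scope group_scope.

Definition conjugate (G : groupType) (g h : G) : Prop := exists a, g ^ a = h.

Definition is_word (G : groupType) (S w : seq G) : bool :=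
  all (fun s => (s \in S) || (s^-1 \in S)) w.

Definition word_of (G : groupType) (S : seq G) (g : G) (w : seq G) : Prop :=
  is_word S w /\ \prod_(s <- w) s = g.

Definition generates (G : groupType) (S : seq G) : Prop :=
  forall g, exists w, word_of S g w.

Definition is_word_length (G : groupType) (S : seq G) (g : G) : nat -> Prop :=
  is_min (fun k => exists2 w, word_of S g w & size w = k).

Definition word_length_le (G : groupType) (S : seq G) (g : G) (n : nat) : Prop :=
  exists2 k, is_word_length S g k & (k <= n)%N.

(* [is_CD g h k]: CD(g, h) is defined (some finite quotient distinguishes the
   conjugacy classes of g and h) and equal to k. *)
Definition is_CD (G : groupType) (g h : G) : nat -> Prop :=
  is_min (fun k => exists (Q : finGroupType) (phi : {multiplicative G -> Q}),
    [/\ forall q, exists x, phi x = q, ~ conjugate (phi g) (phi h)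
      & #|Q| = k]).

(* [is_Conj S n N]: CD(g, h) is defined for all non-conjugate g and h of length
   at most n, and N is the maximum of its values over these pairs. *)
Definition is_Conj (G : groupType) (S : seq G) (n N : nat) : Prop :=
  let pair_in_ball g h :=
    [/\ ~ conjugate g h, word_length_le S g n & word_length_le S h n] in
  (forall g h, pair_in_ball g h -> exists2 k, is_CD g h k & (k <= N)%N)
  /\ (exists g h, pair_in_ball g h /\ is_CD g h N).

Definition is_Conj_function (G : groupType) (S : seq G) (f : nat -> nat) : Prop :=
  forall n, (0 < n)%N -> is_Conj S n (f n).

End Groups.

Section Heisenberg.
Variable m : nat.
Local Open Scope ring_scope.

Definition heis_mx (x : 'rV[int]_m) (y : 'cV[int]_m) (z : int) :
    'M[int]_(1 + (m + 1)) :=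
  block_mx 1%:M (row_mx x z%:M) 0 (block_mx 1%:M y 0 1%:M).

Definition is_heis (M : 'M[int]_(1 + (m + 1))) : bool :=
  M == heis_mx (lsubmx (ursubmx M)) (ursubmx (drsubmx M))
               (rsubmx (ursubmx M) 0 0).

Lemma is_heisP (M : 'M[int]_(1 + (m + 1))) :
  reflect (exists x y z, M = heis_mx x y z) (is_heis M).
Proof.
apply: (iffP eqP) => [->|[x [y [z ->]]]]; first by do 3 eexists.
by rewrite block_mxKur block_mxKdr block_mxKur row_mxKl row_mxKr mxE eqxx.
Qed.

Lemma heis_mx_is_heis x y z : is_heis (heis_mx x y z).
Proof. by apply/is_heisP; exists x, y, z. Qed.

Lemma heis_mxM x y z x' y' z' :
  heis_mx x y z *m heis_mx x' y' z' =
    heis_mx (x + x') (y + y') (z + z' + (x *m y') 0 0).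
Proof.
rewrite /heis_mx mulmx_block mul_row_block mulmx_block.
rewrite !(mul0mx, mulmx0, mul1mx, mulmx1, addr0, add0r) add_row_mx.
congr block_mx; last by rewrite [y' + y]addrC.
congr row_mx; first by rewrite addrC.
apply/matrixP=> i j; rewrite !ord1 !mxE eqxx !mulr1n.
by rewrite addrA addrAC [z' + z]addrC.
Qed.

Lemma heis_mx0 : heis_mx 0 0 0 = 1%:M.
Proof.
rewrite /heis_mx -scalar_mx_block.
by rewrite raddf0 row_mx0 -scalar_mx_block.
Qed.

Lemma heis_mul_subproof (M N : 'M[int]_(1 + (m + 1))) :
  is_heis M -> is_heis N -> is_heis (M *m N).
Proof.
move=> /is_heisP[x [y [z ->]]] /is_heisP[x' [y' [z' ->]]].
by rewrite heis_mxM heis_mx_is_heis.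
Qed.

Lemma heis_one_subproof : is_heis 1%:M.
Proof. by rewrite -heis_mx0 heis_mx_is_heis. Qed.

Lemma heis_mx_left_inverse x y z :
  heis_mx (- x) (- y) ((x *m y) 0 0 - z) *m heis_mx x y z = 1%:M.
Proof.
by rewrite heis_mxM !addNr mulNmx [(- (x *m y)) 0 0]mxE subrK subrr heis_mx0.
Qed.

Lemma heis_inv_subproof (M : 'M[int]_(1 + (m + 1))) :
  is_heis M -> is_heis (invmx M) /\ M \in unitmx.
Proof.
move=> /is_heisP[x [y [z ->]]].
have [_ uM] := mulmx1_unit (heis_mx_left_inverse x y z).
split=> //; rewrite -[invmx _]mul1mx -(heis_mx_left_inverse x y z).
by rewrite mulmxK // heis_mx_is_heis.
Qed.

Record heis := Heis { heis_val : 'M[int]_(1 + (m + 1)); _ : is_heis heis_val }.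

HB.instance Definition _ := [isSub for heis_val].
HB.instance Definition _ := [Choice of heis by <:].

Definition heis_mul (a b : heis) : heis :=
  Heis (heis_mul_subproof (valP a) (valP b)).
Definition heis_one : heis := Heis heis_one_subproof.
Definition heis_inv (a : heis) : heis :=
  Heis (heis_inv_subproof (valP a)).1.

Lemma heis_mulA : associative heis_mul.
Proof. by move=> a b c; apply: val_inj; rewrite /= mulmxA. Qed.
Lemma heis_mul1 : left_id heis_one heis_mul.
Proof. by move=> a; apply: val_inj; rewrite /= mul1mx. Qed.
Lemma heis_mulr1 : right_id heis_one heis_mul.
Proof. by move=> a; apply: val_inj; rewrite /= mulmx1. Qed.
Lemma heis_mulV : left_inverse heis_one heis_inv heis_mul.
Proof.
move=> a; apply: val_inj => /=.
by rewrite mulVmx //; have [] := heis_inv_subproof (valP a).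
Qed.
Lemma heis_mulrV : right_inverse heis_one heis_inv heis_mul.
Proof.
move=> a; apply: val_inj => /=.
by rewrite mulmxV //; have [] := heis_inv_subproof (valP a).
Qed.

HB.instance Definition _ :=
  isGroup.Build heis heis_mulA heis_mul1 heis_mulr1 heis_mulV heis_mulrV.

Definition heis_of x y z : heis := Heis (heis_mx_is_heis x y z).

Lemma heis_ofM x y z x' y' z' :
  (heis_of x y z * heis_of x' y' z')%g =
    heis_of (x + x') (y + y') (z + z' + (x *m y') 0 0).
Proof. by apply: val_inj; rewrite /= heis_mxM. Qed.

Lemma heis_of0 : heis_of 0 0 0 = 1%g.
Proof. by apply: val_inj; rewrite /= heis_mx0. Qed.

End Heisenberg.

Section FiniteGeneration.
Variable m : nat.
Local Open Scope ring_scope.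
Local Open Scope group_scope.

Definition heis_gens : seq (heis m) :=
  [seq heis_of (delta_mx 0 j) 0 0 | j : 'I_m]
  ++ [seq heis_of 0 (delta_mx j 0) 0 | j : 'I_m] ++ [:: heis_of 0 0 1%R].

Let gen (g : heis m) := exists w, word_of heis_gens g w.

Let gen_mem g : g \in heis_gens -> gen g.
Proof. by move=> gS; exists [:: g]; rewrite /word_of /= gS big_seq1. Qed.

Let gen1 : gen 1.
Proof. by exists [::]; rewrite /word_of big_nil. Qed.

Let genM g h : gen g -> gen h -> gen (g * h).
Proof.
move=> [v [Sv <-]] [w [Sw <-]]; exists (v ++ w).
by rewrite /word_of /is_word all_cat big_cat; split=> //; apply/andP.
Qed.

Let genV g : gen g -> gen g^-1.
Proof.
case=> w [Sw <-]; elim: w Sw => [|s w IH] /= Sw.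
  by rewrite big_nil invg1.
case/andP: Sw => Ss /IH gw; rewrite big_cons invgM; apply: genM gw _.
by exists [:: s^-1]; rewrite /word_of /= invgK orbC Ss big_seq1.
Qed.

Let genZ (V : zmodType) (F : V -> heis m) (v : V) (k : int) :
  {morph F : a b / (a + b)%R >-> a * b} -> gen (F v) -> gen (F (v *~ k)%R).
Proof.
move=> FD gv; have F0 : F 0%R = 1.
  by apply: (mulgI (F 0%R)); rewrite -FD addr0 mulg1.
have gn n : gen (F (v *+ n)%R).
  elim: n => [|n IH]; first by rewrite mulr0n F0.
  by rewrite mulrS FD; apply: genM.
case: k => n; first exact: gn.
suff -> : F (v *~ Negz n)%R = (F (v *+ n.+1)%R)^-1 by apply: genV.
by apply: (mulIg (F (v *+ n.+1)%R)); rewrite -FD NegzE mulrNz addNr mulVg.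
Qed.

Let genX x : gen (heis_of x 0 0).
Proof.
have FD : {morph (fun x => heis_of x 0 0 : heis m) :
    a b / (a + b)%R >-> a * b}.
  by move=> a b /=; rewrite heis_ofM mulmx0 mxE !addr0.
rewrite [x]row_sum_delta.
apply: (big_ind (fun x => gen (heis_of x 0 0))) => [|a b ga gb|j _].
- by rewrite heis_of0.
- by rewrite FD; apply: genM.
- rewrite -[x 0%R j]intz scaler_int; apply: genZ FD _; apply: gen_mem.
  by rewrite mem_cat; apply/orP; left; apply/imageP; exists j.
Qed.

Let genY y : gen (heis_of 0 y 0).
Proof.
have FD : {morph (fun y => heis_of 0 y 0 : heis m) :
    a b / (a + b)%R >-> a * b}.
  by move=> a b /=; rewrite heis_ofM mul0mx mxE !addr0.
rewrite -[y]trmxK [y^T%R]row_sum_delta linear_sum /=.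
apply: (big_ind (fun y => gen (heis_of 0 y 0))) => [|a b ga gb|j _].
- by rewrite heis_of0.
- by rewrite FD; apply: genM.
- rewrite linearZ /= trmx_delta -[y^T%R 0%R j]intz scaler_int.
  apply: genZ FD _; apply: gen_mem.
  rewrite mem_cat; apply/orP; right; rewrite mem_cat; apply/orP; left.
  by apply/imageP; exists j.
Qed.

Let genC z : gen (heis_of 0 0 z).
Proof.
have FD : {morph (fun z => heis_of 0 0 z : heis m) :
    a b / (a + b)%R >-> a * b}.
  by move=> a b /=; rewrite heis_ofM mul0mx mxE !addr0.
rewrite -[z]intz; apply: genZ FD _; apply: gen_mem.
by rewrite !mem_cat mem_head !orbT.
Qed.

Lemma heis_gens_generates : generates heis_gens.
Proof.
case=> M HM; have /is_heisP [x [y [z eM]]] := HM.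
have -> : Heis HM = heis_of 0 y 0 * heis_of 0 0 z * heis_of x 0 0.
  rewrite !heis_ofM !mulmx0 !mxE !(addr0, add0r).
  exact: val_inj.
by apply: genM (genX x); apply: genM.
Qed.

End FiniteGeneration.

(* Main.v *)
From HB Require Import structures.
From mathcomp Require Import all_boot all_order all_algebra all_fingroup.
From mathcomp Require Import cyclic boolp zify ring.
Require Import Defs.

Set Implicit Arguments.
Unset Strict Implicit.
Unset Printing Implicit Defensive.

(** Write [Z] for the central element with coordinates (0, 0, 1).  Conjugation
    fixes the coordinates x and y and moves z by the integers x.v - u.y, which
    form the ideal generated by the gcd d of the entries of x and y.  Hence
    (x, y, z) and (x', y', z') are conjugate iff x = x', y = y' and d divides
    z - z'.  Everything else rests on this, and on the fact that in the ball of
    radius n the entries of x and y are O(n) while z is O(n^2) ([ball_box]).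

    Upper bound ([mod_heis_separates]).  The quotient H(Z/k) has order
    k^(2m+1), so it is enough to separate two non-conjugate elements of the
    ball modulo some k = O(n).  If x or y differ, any k larger than twice the
    entries works.  If they agree and d > 0, take k = d, which is O(n) because d
    divides a nonzero entry: modulo d both elements become central, with
    different z.  If d = 0, both elements are central and z - z' is a nonzero
    integer of size O(n^2); two consecutive integers of order n cannot both
    divide it, since their product would divide it too.

    Lower bound ([card_ge_order_center], [order_center_dvd]).  Let 2^(K+1) be
    the power of 2 just above n and compare g = (2^(K+1) e, 0, 0), e a basis
    vector, with g Z^(2^K).  They have length O(n) and are not conjugate.  If
    phi : H -> Q separates them, then c = phi(Z) has
    c^(2^K) outside <c^(2^(K+1))>, because powers of c^(2^(K+1)) are commutators
    of phi(g); as 2 is prime this forces 2^(K+1) | #[c].  On the other hand the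
    commutators with the standard generators recover every entry of x and y
    modulo #[c] from phi(x, y, z), and then z modulo #[c] as well.  So the
    (#[c])^(2m+1) triples with entries in [0, #[c]) have distinct images, and
    |Q| >= (2^(K+1))^(2m+1) > n^(2m+1).  The choice of a power of 2, rather than
    of a prime of size n, makes the existence of a suitable modulus evident. *)

Import Order.TTheory GRing.Theory Num.Theory.

(** * The Heisenberg group over a finite commutative ring *)

Section FiniteHeisenberg.
Variables (R : finComNzRingType) (m : nat).
Local Open Scope ring_scope.

(** Triples of coordinates rather than matrices, so that the cardinality is
    immediate; the name keeps the direct product group law of the underlying
    product type out of the way. *)
Definition heis_over : Type := ('rV[R]_m * 'cV[R]_m * R)%type.

HB.instance Definition _ :=
  Finite.copy heis_over ('rV[R]_m * 'cV[R]_m * R)%type.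

Definition heis_over_mul (g h : heis_over) : heis_over :=
  (g.1.1 + h.1.1, g.1.2 + h.1.2, g.2 + h.2 + (g.1.1 *m h.1.2) 0 0).

Definition heis_over_one : heis_over := (0, 0, 0).

Definition heis_over_inv (g : heis_over) : heis_over :=
  (- g.1.1, - g.1.2, (g.1.1 *m g.1.2) 0 0 - g.2).

Lemma heis_over_mulA : associative heis_over_mul.
Proof.
move=> [[x y] z] [[x' y'] z'] [[x'' y''] z''].
rewrite /heis_over_mul /= mulmxDl mulmxDr !addrA.
rewrite [(_ *m _ + _ *m _) 0 0]mxE [(_ *m _ + _ *m _) 0 0]mxE.
by congr (_, _, _); ring.
Qed.

Lemma heis_over_mul1 : left_id heis_over_one heis_over_mul.
Proof.
by move=> [[x y] z]; rewrite /heis_over_mul /= mul0mx mxE addr0 !add0r.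
Qed.

Lemma heis_over_mulV : left_inverse heis_over_one heis_over_inv heis_over_mul.
Proof.
move=> [[x y] z]; rewrite /heis_over_mul /= mulNmx !addNr.
by rewrite [(- (x *m y)) 0 0]mxE subrK subrr.
Qed.

HB.instance Definition _ := Finite_isGroup.Build heis_over
  heis_over_mulA heis_over_mul1 heis_over_mulV.

Lemma card_heis_over : #|{: heis_over}| = (#|R| ^ (2 * m + 1))%N.
Proof.
by rewrite !card_prod !card_mx mul1n muln1 -expnD -expnSr addn1 mul2n addnn.
Qed.

Lemma heis_overM x y z x' y' z' :
  (((x, y, z) : heis_over) * ((x', y', z') : heis_over))%g =
    (x + x', y + y', z + z' + (x *m y') 0 0) :> heis_over.
Proof. by []. Qed.

End FiniteHeisenberg.

(** * Coordinates and conjugacy in the integral Heisenberg group *)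

Section Conjugacy.
Local Open Scope group_scope.

(** An inverse-free form of conjugacy: Heisenberg inverses never have to be
    computed. *)
Lemma conjugateP (G : groupType) (g h : G) :
  conjugate g h <-> exists a, g * a = a * h.
Proof.
split=> -[a]; first by move=> <-; exists a; rewrite -conjgC.
by rewrite conjgC => /mulgI; exists a.
Qed.

End Conjugacy.

Section Coordinates.
Variable m : nat.
Implicit Types (g h : heis m) (x : 'rV[int]_m) (y : 'cV[int]_m) (z : int).
Local Open Scope ring_scope.

Definition heis_x g : 'rV[int]_m := lsubmx (ursubmx (val g)).
Definition heis_y g : 'cV[int]_m := ursubmx (drsubmx (val g)).
Definition heis_z g : int := rsubmx (ursubmx (val g)) 0 0.

Lemma heis_xK x y z : heis_x (heis_of x y z) = x.
Proof. by rewrite /heis_x /= /heis_mx block_mxKur row_mxKl. Qed.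
Lemma heis_yK x y z : heis_y (heis_of x y z) = y.
Proof. by rewrite /heis_y /= /heis_mx block_mxKdr block_mxKur. Qed.
Lemma heis_zK x y z : heis_z (heis_of x y z) = z.
Proof. by rewrite /heis_z /= /heis_mx block_mxKur row_mxKr mxE eqxx. Qed.
Definition heisK := (heis_xK, heis_yK, heis_zK).

Lemma heis_eta g : heis_of (heis_x g) (heis_y g) (heis_z g) = g.
Proof. by apply/val_inj/esym/eqP; case: g. Qed.

Lemma heis_ofP g : exists x y z, g = heis_of x y z.
Proof. by exists (heis_x g), (heis_y g), (heis_z g); rewrite heis_eta. Qed.

Lemma heis_of_inj x y z x' y' z' :
  heis_of x y z = heis_of x' y' z' -> [/\ x = x', y = y' & z = z'].
Proof.
move=> e; rewrite -(heis_xK x y z) -{2}(heis_yK x y z) -{3}(heis_zK x y z) e.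
by rewrite !heisK.
Qed.

(** The group is two-step nilpotent: commuting two elements costs a central
    factor, the symplectic pairing of their (x, y) parts. *)
Lemma heis_of_mulC x y z (u : 'rV_m) (v : 'cV_m) w :
  (heis_of x y z * heis_of u v w)%g =
  (heis_of u v w * heis_of x y z * heis_of 0 0 ((x *m v) 0 0 - (u *m y) 0 0))%g.
Proof.
rewrite !heis_ofM !mulmx0 !mxE !addr0 [u + x]addrC [v + y]addrC.
by congr heis_of; ring.
Qed.

Lemma conjugate_heis_of x y z x' y' z' :
  conjugate (heis_of x y z) (heis_of x' y' z') <->
  [/\ x = x', y = y' &
      exists (u : 'rV_m) (v : 'cV_m), z' - z = (x *m v) 0 0 - (u *m y) 0 0].
Proof.
rewrite conjugateP; split=> [[a]|[-> -> [u [v e]]]].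
  have [u [v [w ->]]] := heis_ofP a.
  rewrite !heis_ofM => /heis_of_inj [ex ey ez].
  have {}ex : x = x' by apply: (addrI u); rewrite -ex addrC.
  have {}ey : y = y' by apply: (addrI v); rewrite -ey addrC.
  split=> //; exists u, v; rewrite ey.
  have -> : z' = w + z' + (u *m y') 0 0 - w - (u *m y') 0 0 by ring.
  by rewrite -ez; ring.
exists (heis_of u v 0); rewrite !heis_ofM [u + _]addrC [v + _]addrC.
move/eqP: e; rewrite subr_eq => /eqP ->.
by congr heis_of; ring.
Qed.

End Coordinates.

(** * Reduction modulo k *)

Section Reduction.
Variables (m k : nat).
Local Open Scope ring_scope.

Lemma intr_Zp_eq0 (z : int) : (1 < k)%N -> (z%:~R == 0 :> 'Z_k) = (k %| z)%Z.
Proof.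
move=> k1; have H (n : nat) : (n%:R == 0 :> 'Z_k) = (k %| n)%N.
  by rewrite Zp_nat -val_eqE /= Zp_cast.
rewrite dvdzE; case: z => n; first exact: H.
by rewrite NegzE mulrNz oppr_eq0 abszN H.
Qed.

Definition mod_heis (g : heis m) : heis_over 'Z_k m :=
  (map_mx intr (heis_x g), map_mx intr (heis_y g), (heis_z g)%:~R).

Lemma mod_heisM : {morph mod_heis : g h / (g * h)%g}.
Proof.
move=> g h; have [x [y [z ->]]] := heis_ofP g.
have [x' [y' [z' ->]]] := heis_ofP h.
rewrite heis_ofM /mod_heis !heisK heis_overM !map_mxD !intrD.
by rewrite -map_mxM [map_mx _ (x *m y') _ _]mxE.
Qed.

HB.instance Definition _ :=
  isMultiplicative.Build (heis m) (heis_over 'Z_k m) mod_heis mod_heisM.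

Lemma mod_heis_surj (q : heis_over 'Z_k m) : exists g, mod_heis g = q.
Proof.
case: q => [[x y] z].
exists (heis_of (map_mx (fun a : 'Z_k => (a : nat)%:Z) x)
                (map_mx (fun a : 'Z_k => (a : nat)%:Z) y) (z : nat)%:Z).
rewrite /mod_heis !heisK; congr (_, _, _); last exact: natr_Zp.
  by apply/matrixP => i j; rewrite !mxE; apply: natr_Zp.
by apply/matrixP => i j; rewrite !mxE; apply: natr_Zp.
Qed.

Lemma card_heis_Zp : (1 < k)%N -> #|{: heis_over 'Z_k m}| = (k ^ (2 * m + 1))%N.
Proof. by move=> k1; rewrite card_heis_over card_ord Zp_cast. Qed.

(** The third conclusion holds because a pair that vanishes modulo k leaves both
    images central, and conjugate central elements are equal. *)
Lemma conjugate_mod_heis x y z x' y' z' : (1 < k)%N ->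
  conjugate (mod_heis (heis_of x y z)) (mod_heis (heis_of x' y' z')) ->
  [/\ forall j, (k %| x 0%R j - x' 0%R j)%Z,
      forall j, (k %| y j 0%R - y' j 0%R)%Z &
      (forall j, (k %| x 0%R j)%Z) -> (forall j, (k %| y j 0%R)%Z) ->
      (k %| z - z')%Z].
Proof.
move=> k1 /conjugateP[[[u v] w]].
rewrite /mod_heis !heisK !heis_overM => e.
have /= ex := congr1 (fun q : heis_over 'Z_k m => q.1.1) e.
have /= ey := congr1 (fun q : heis_over 'Z_k m => q.1.2) e.
have {e} /= ez := congr1 (fun q : heis_over 'Z_k m => q.2) e.
have {}ex : map_mx intr x = map_mx intr x' :> 'rV['Z_k]_m.
  by apply: (addrI u); rewrite -ex addrC.
have {}ey : map_mx intr y = map_mx intr y' :> 'cV['Z_k]_m.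
  by apply: (addrI v); rewrite -ey addrC.
split=> [j|j|xk yk].
- move/rowP/(_ j): ex; rewrite !mxE => ex.
  by rewrite -intr_Zp_eq0 // intrB ex subrr.
- move/colP/(_ j): ey; rewrite !mxE => ey.
  by rewrite -intr_Zp_eq0 // intrB ey subrr.
- have x0 : map_mx intr x = 0 :> 'rV['Z_k]_m.
    by apply/rowP => j; rewrite !mxE; apply/eqP; rewrite intr_Zp_eq0.
  have y0 : map_mx intr y = 0 :> 'cV['Z_k]_m.
    by apply/colP => j; rewrite !mxE; apply/eqP; rewrite intr_Zp_eq0.
  move: ez; rewrite -ey x0 y0 mul0mx mulmx0 mxE !addr0 [w + _]addrC.
  by move=> /addIr ez; rewrite -intr_Zp_eq0 // intrB ez subrr.
Qed.

End Reduction.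

(** * Separating conjugacy classes modulo a small k *)

Section Separation.
Variable m : nat.
Local Open Scope ring_scope.

(** Applied to the values x.v - u.y, this yields the gcd of the entries of x and
    y along with its Bezout coefficients. *)
Lemma int_subgroup_principal (P : int -> Prop) :
  P 0 -> (forall a b, P a -> P b -> P (a - b)) ->
  exists2 d : nat, P d%:Z & forall a, P a -> (d %| a)%Z.
Proof.
move=> P0 PB.
have PN a : P a -> P (- a) by rewrite -[- a]add0r; apply: PB.
have PD a b : P a -> P b -> P (a + b).
  by move=> Pa Pb; rewrite -[b]opprK; apply: PB => //; apply: PN.
have PM a (q : int) : P a -> P (q * a).
  move=> Pa; have Pn (n : nat) : P (n%:Z * a).
    by elim: n => [|n IH]; rewrite ?mul0r // intS mulrDl mul1r; apply: PD.
  by case: q => n; rewrite ?NegzE ?mulNr //; apply: PN.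
have [[a [Pa a0]]|nP] := pselect (exists a, P a /\ a != 0); last first.
  exists 0%N => // a Pa; rewrite dvd0z; apply/eqP/not_notP => /eqP a0.
  by apply: nP; exists a.
have exd : exists d : nat, `[< P d%:Z /\ (0 < d)%N >].
  exists `|a|%N; apply/asboolP; split; last by rewrite absz_gt0.
  by rewrite abszE; case: ger0P => _ //; apply: PN.
case: (ex_minnP exd) => d /asboolP[Pd d0] dmin; exists d => // b Pb.
have Pr : P (b %% d)%Z.
  have -> : (b %% d)%Z = b - (b %/ d)%Z * d by [].
  by apply: PB => //; apply: PM.
have r_ge0 : 0 <= (b %% d)%Z by rewrite modz_ge0 // -lt0n.
have r_lt : (b %% d)%Z < d by rewrite ltz_pmod.
apply/dvdz_mod0P/eqP/contraT => r0.
have : (d <= `|(b %% d)%Z|)%N.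
  by apply: dmin; apply/asboolP; rewrite gez0_abs // absz_gt0.
by rewrite leqNgt -ltz_nat gez0_abs // r_lt.
Qed.

(** Consecutive integers are coprime, so if both divided N then their product
    would, against the bound on N. *)
Lemma exists_small_nondivisor (N t : nat) :
  (0 < N)%N -> (N < t.+1 * t.+2)%N ->
  exists2 k, (t < k <= t.+2)%N & ~~ (k %| N)%N.
Proof.
move=> N0 Nt.
have [d1|] := boolP (t.+1 %| N)%N; last by exists t.+1; rewrite // ltnSn leqnSn.
have [d2|] := boolP (t.+2 %| N)%N; last by exists t.+2; rewrite // leqnSn leqnn.
have : (t.+1 * t.+2 %| N)%N by rewrite Gauss_dvd ?d1 ?d2 // coprimenS.
by move=> /(dvdn_leq N0); rewrite leqNgt Nt.
Qed.

(** The last coordinate has weight 2, so that the box of size a is comparable to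
    the ball of radius a in the word metric. *)
Definition heis_box (a : nat) (g : heis m) :=
  [/\ forall j, (`|heis_x g 0%R j| <= a)%N,
      forall j, (`|heis_y g j 0%R| <= a)%N & (`|heis_z g| <= a ^ 2)%N].

(** A modulus linear in a suffices even though z is quadratic in a: z matters
    only modulo the gcd d of x and y, and d is at most a unless it is 0. *)
Lemma mod_heis_separates (a : nat) (g h : heis m) :
  heis_box a g -> heis_box a h -> ~ conjugate g h ->
  exists2 k, (1 < k <= 2 * a + 3)%N & ~ conjugate (mod_heis k g) (mod_heis k h).
Proof.
have [x [y [z ->]]] := heis_ofP g; have [x' [y' [z' ->]]] := heis_ofP h.
case=> + + + [] ; rewrite !heisK => xa ya za xa' ya' za' ncg.
have bd (b c : int) : (`|b| <= a)%N -> (`|c| <= a)%N -> b != c ->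
    ~~ ((2 * a + 2)%N %| b - c)%Z.
  move=> ba ca bc; rewrite dvdzE gtnNdvd //; lia.
have k1 : (1 < 2 * a + 2)%N by lia.
have [|nx] := boolP [exists j, x 0 j != x' 0 j].
  case/existsP => j xj; exists (2 * a + 2)%N; first lia.
  case/(conjugate_mod_heis k1) => /(_ j) + _ _.
  by apply/negP; apply: bd.
have [|ny] := boolP [exists j, y j 0 != y' j 0].
  case/existsP => j yj; exists (2 * a + 2)%N; first lia.
  case/(conjugate_mod_heis k1) => _ /(_ j) + _.
  by apply/negP; apply: bd.
have {nx xa'} ex : x' = x.
  apply/rowP => j; apply/eqP/contraT => xj; case/negP: nx.
  by apply/existsP; exists j; rewrite eq_sym.
have {ny ya'} ey : y' = y.
  apply/colP => j; apply/eqP/contraT => yj; case/negP: ny.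
  by apply/existsP; exists j; rewrite eq_sym.
subst x' y'.
(* The displacements of z under conjugation. *)
pose I t := exists (u : 'rV_m) (v : 'cV_m), t = (x *m v) 0 0 - (u *m y) 0 0.
have nI : ~ I (z' - z) by move=> Iz; apply/ncg/conjugate_heis_of.
have [||d Id dI] := @int_subgroup_principal I.
- by exists 0, 0; rewrite mulmx0 mul0mx !mxE subrr.
- move=> _ _ [u [v ->]] [u' [v' ->]]; exists (u - u'), (v - v').
  rewrite mulmxBr mulmxBl [(x *m v - _) 0 0]mxE [(u *m y - _) 0 0]mxE.
  by rewrite [(- (x *m v')) 0 0]mxE [(- (u' *m y)) 0 0]mxE; ring.
have dx j : (d %| x 0%R j)%Z.
  by apply: dI; exists 0, (delta_mx j 0); rewrite -colE mul0mx !mxE subr0.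
have dy j : (d %| y j 0%R)%Z.
  rewrite -[y j 0]opprK dvdzE abszN -dvdzE; apply: dI; exists (delta_mx 0 j), 0.
  by rewrite -rowE mulmx0 !mxE sub0r.
have ndz : ~~ (d %| z - z')%Z.
  apply/negP; rewrite -opprB dvdzE abszN -dvdzE => /dvdzP[q eq].
  apply: nI; rewrite eq.
  case: Id => u [v ->]; exists (q *: u), (q *: v).
  rewrite -scalemxAr -scalemxAl.
  by rewrite [(q *: (x *m v)) 0 0]mxE [(q *: (u *m y)) 0 0]mxE mulrBr.
have d1 : d != 1%N by apply: contraNneq ndz => ->; rewrite dvd1z.
(* If d > 0 then d is itself a suitable modulus: it divides a nonzero entry of
   x or y, hence is at most a. *)
have [d0|d0] := posnP d; last first.
  have k2 : (1 < d)%N by lia.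
  have da : (d <= a)%N.
    have small b : (`|b| <= a)%N -> b != 0 -> (d %| b)%Z -> (d <= a)%N.
      move=> ba b0; rewrite dvdzE => /dvdn_leq db.
      by apply: leq_trans ba; apply: db; rewrite absz_gt0.
    have [/existsP[j xj]|nx] := boolP [exists j, x 0 j != 0].
      exact: small (xa j) xj _.
    have [/existsP[j yj]|ny] := boolP [exists j, y j 0 != 0].
      exact: small (ya j) yj _.
    have x0 : x = 0.
      apply/rowP => j; rewrite mxE; apply/eqP/contraT => xj; case/negP: nx.
      by apply/existsP; exists j.
    have y0 : y = 0.
      apply/colP => j; rewrite mxE; apply/eqP/contraT => xj; case/negP: ny.
      by apply/existsP; exists j.
    case: Id => u [v]; rewrite x0 y0 mul0mx mulmx0 !mxE subrr => -[] ed.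
    by rewrite ed in d0.
  exists d; first lia.
  by case/(conjugate_mod_heis k2) => _ _ /(_ dx dy); apply/negP.
(* Now d = 0, so x = y = 0 and the two elements are distinct and central. *)
rewrite {}d0 {d Id dI d1} dvd0z subr_eq0 in dx dy ndz *.
(* |z - z'| <= 2 a^2 < (2 a + 2) (2 a + 3). *)
have [||k kt kN] := @exists_small_nondivisor `|z - z'|%N (2 * a).+1.
- by rewrite absz_gt0 subr_eq0.
- by nia.
have k2 : (1 < k)%N by lia.
exists k; first lia.
case/(conjugate_mod_heis k2) => _ _; have d0k b : (0 %| b)%Z -> (k %| b)%Z.
  by rewrite dvd0z => /eqP ->; rewrite dvdz0.
move=> /(_ (fun j => d0k _ (dx j)) (fun j => d0k _ (dy j))).
by rewrite dvdzE; apply/negP.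
Qed.

End Separation.

(** * Word length *)

Section WordLength.
Variables (G : groupType) (S : seq G).
Local Open Scope group_scope.

Lemma exists_is_min (P : nat -> Prop) : (exists n, P n) -> exists n, is_min P n.
Proof.
move=> [n Pn]; have exP : exists n, `[< P n >] by exists n; apply/asboolP.
case: (ex_minnP exP) => k /asboolP Pk kmin; exists k; split=> // j Pj.
by apply: kmin; apply/asboolP.
Qed.

Lemma word_length_leP (g : G) n :
  word_length_le S g n <-> exists2 w, word_of S g w & (size w <= n)%N.
Proof.
split=> [[k [[w gw <-] _] kn]|[w gw wn]]; first by exists w.
pose attained k := exists2 w, word_of S g w & size w = k.
have [|k kmin] := @exists_is_min attained.
  by exists (size w), w.
by exists k => //; apply: leq_trans wn; apply: kmin.2; exists w.
Qed.

Lemma word_length_leW (g : G) n n' :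
  (n <= n')%N -> word_length_le S g n -> word_length_le S g n'.
Proof. by move=> nn' [k gk kn]; exists k => //; apply: leq_trans nn'. Qed.

Lemma word_length_le1 : word_length_le S 1 0.
Proof. by apply/word_length_leP; exists [::] => //; rewrite /word_of big_nil. Qed.

Lemma word_length_leM (g h : G) a b :
  word_length_le S g a -> word_length_le S h b ->
  word_length_le S (g * h) (a + b).
Proof.
move=> /word_length_leP[v [Sv <-] va] /word_length_leP[w [Sw <-] wb].
apply/word_length_leP; exists (v ++ w); last by rewrite size_cat leq_add.
by rewrite /word_of /is_word all_cat big_cat; split=> //; apply/andP.
Qed.

Lemma word_length_leX (g : G) a n :
  word_length_le S g a -> word_length_le S (g ^+ n) (n * a).
Proof.
move=> ga; elim: n => [|n IH]; first exact: word_length_le1.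
by rewrite expgS mulSn; apply: word_length_leM.
Qed.

Lemma generates_word_length (g : G) :
  generates S -> exists n, word_length_le S g n.
Proof.
by move=> /(_ g)[w gw]; exists (size w); apply/word_length_leP; exists w.
Qed.

Lemma exists_short_nontrivial (g : G) :
  generates S -> g != 1 -> exists2 s, s != 1 & word_length_le S s 1.
Proof.
move=> /(_ g)[w [Sw <-]].
elim: w Sw => [|s w IH] /=; first by rewrite big_nil eqxx.
case/andP=> Ss Sw; rewrite big_cons.
have [->|s1 _] := eqVneq s 1; first by rewrite mul1g; apply: IH.
exists s => //; apply/word_length_leP; exists [:: s] => //.
by rewrite /word_of /= Ss big_seq1.
Qed.

End WordLength.

(** * Coordinates of the elements of a ball *)

Section Growth.
Variables (m : nat) (S : seq (heis m)).
Local Open Scope ring_scope.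

Lemma heis_boxW a b (g : heis m) : (a <= b)%N -> heis_box a g -> heis_box b g.
Proof.
move=> ab [xa ya za].
split=> [j|j|]; [exact: leq_trans ab|exact: leq_trans ab|].
by apply: leq_trans za _; rewrite leq_exp2r.
Qed.

Lemma heis_box_exists (g : heis m) : exists a, heis_box a g.
Proof.
exists (\max_j `|heis_x g 0%R j| + \max_j `|heis_y g j 0%R| + `|heis_z g|)%N.
split=> [j|j|].
- by rewrite -addnA; apply: leq_trans (leq_addr _ _); apply: (leq_bigmax j).
- rewrite -addnA addnCA; apply: leq_trans (leq_addr _ _).
  exact: (leq_bigmax (F := fun j => `|heis_y g j 0%R|%N) j).
- by nia.
Qed.

Lemma letters_box :
  exists A, forall s, (s \in S) || (s^-1%g \in S) -> heis_box A s.
Proof.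
suff [A HA] : exists A, forall s, s \in S -> heis_box A s /\ heis_box A s^-1%g.
  by exists A => s /orP[/HA[]//|/HA[_]]; rewrite invgK.
elim: S => [|s T [A HA]]; first by exists 0%N.
have [a sa] := heis_box_exists s; have [b sb] := heis_box_exists s^-1%g.
exists (A + a + b)%N => t; rewrite inE => /orP[/eqP->|/HA[tA tA']].
  by split; [apply: heis_boxW sa | apply: heis_boxW sb]; lia.
by split; [apply: heis_boxW tA | apply: heis_boxW tA']; lia.
Qed.

Lemma absz_add_le (a b : int) (p q : nat) :
  (`|a| <= p -> `|b| <= q -> `|(a + b)%R| <= p + q)%N.
Proof. lia. Qed.

Lemma absz_dot (x : 'rV[int]_m) (y : 'cV[int]_m) (a b : nat) :
  (forall j, (`|x 0%R j| <= a)%N) -> (forall j, (`|y j 0%R| <= b)%N) ->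
  (`|((x *m y) 0 0)%R| <= m * (a * b))%N.
Proof.
move=> xa yb; rewrite mxE -[m in (m * _)%N]card_ord -sum_nat_const.
apply: (big_ind2 (fun (u : int) v => (`|u| <= v)%N)) => // [u v u' v'|j _].
  exact: absz_add_le.
by rewrite abszM leq_mul.
Qed.

(** Multiplying by a letter adds O(1) to x and y but O(k) to z, where k is the
    length of the word, which sums up to the square of the length. *)
Lemma ball_box : exists2 B, (0 < B)%N &
  forall n g, word_length_le S g n -> heis_box (B * n) g.
Proof.
have [A0 HA0] := letters_box; pose A := A0.+1.
have HA s : (s \in S) || (s^-1%g \in S) -> heis_box A s.
  by move=> /HA0; apply: heis_boxW.
(* The step below needs A <= B and m A <= B. *)
exists (A * m.+1)%N => // n g /word_length_leP[w [Sw <-] wn].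
apply: heis_boxW (leq_mul (leqnn _) wn) _.
elim: w Sw {g n wn} => [|s w IH] /= Sw.
  rewrite big_nil muln0 -heis_of0; split=> [j|j|]; rewrite heisK ?mxE //.
rewrite big_cons; case/andP: Sw => /HA + /IH.
have AB : (A <= A * m.+1)%N by rewrite leq_pmulr.
set B := (A * m.+1)%N in AB *.
have [x [y [z ->]]] := heis_ofP s.
have [x' [y' [z' ->]]] := heis_ofP (\prod_(t <- w) t)%g.
rewrite heis_ofM => -[]; rewrite !heisK => xA yA zA [].
rewrite !heisK => xw yw zw; split=> [j|j|]; rewrite heisK.
- by rewrite mxE mulnS; apply: absz_add_le (xw j); apply: leq_trans AB.
- by rewrite mxE mulnS; apply: absz_add_le (yw j); apply: leq_trans AB.
have tb := absz_dot xA yw.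
have mAB : (m * (A * (B * size w)) <= B * (B * size w))%N.
  by rewrite mulnA leq_mul // /B mulnC leq_mul.
have AB2 : (A ^ 2 <= B ^ 2)%N by rewrite leq_exp2r.
apply: leq_trans (absz_add_le (absz_add_le zA zw) tb) _.
rewrite mulnS sqrnD -!addnA leq_add // leq_add2l.
by apply: leq_trans mAB _; rewrite mul2n -addnn leq_addr.
Qed.

End Growth.

(** * The conjugacy separability function and its upper bound *)

Section Conj.
Variables (m : nat) (S : seq (heis m)).

Lemma is_CD_unique (G : groupType) (g h : G) k k' :
  is_CD g h k -> is_CD g h k' -> k = k'.
Proof. by move=> [P1 m1] [P2 m2]; apply/eqP; rewrite eqn_leq m1 // m2. Qed.

Lemma CD_upper_bound (a : nat) (g h : heis m) :
  heis_box a g -> heis_box a h -> ~ conjugate g h ->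
  exists2 k, is_CD g h k & k <= (2 * a + 3) ^ (2 * m + 1).
Proof.
move=> ga ha /(mod_heis_separates ga ha)[k /andP[k1 kn] nc].
set P := fun k =>
  exists (Q : finGroupType) (phi : {multiplicative heis m -> Q}),
    [/\ forall q, exists x, phi x = q, ~ conjugate (phi g) (phi h)
      & #|Q| = k].
have Pk : P (k ^ (2 * m + 1)).
  exists (heis_over 'Z_k m), (@mod_heis m k).
  by split; [exact: mod_heis_surj | | exact: card_heis_Zp].
have [|N Nmin] := @exists_is_min P; first by exists (k ^ (2 * m + 1)).
exists N => //; apply: leq_trans (Nmin.2 _ Pk) _.
by rewrite leq_exp2r // addn1.
Qed.

(** The maximum that defines Conj exists because the CD values over a ball are
    bounded, and because the ball of radius 1 already contains a non-conjugate
    pair: 1 and a nontrivial letter. *)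
Lemma Conj_upper_bound : generates S ->
  exists f, is_Conj_function S f /\
    exists2 C, 0 < C & forall n, 0 < n -> f n <= (C * n) ^ (2 * m + 1).
Proof.
move=> hS; have [B B0 HB] := ball_box S.
pose bound n := (2 * (B * n) + 3) ^ (2 * m + 1).
have CDb n g h :
    ~ conjugate g h -> word_length_le S g n -> word_length_le S h n ->
    exists2 k, is_CD g h k & k <= bound n.
  by move=> ngh gn hn; apply: CD_upper_bound => //; apply: HB.
pose attained n k := exists g h,
  [/\ ~ conjugate g h, word_length_le S g n & word_length_le S h n] /\
  is_CD g h k.
have exf n : 0 < n -> exists N, is_Conj S n N /\ N <= bound n.
  move=> n0.
  have exv : exists k, `[< attained n k >].
    have Z1 : heis_of 0 0 1%R != 1%g :> heis m.
      by apply/eqP; rewrite -heis_of0 => /heis_of_inj[].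
    have [s s1 sl] := exists_short_nontrivial hS Z1.
    have ns : ~ conjugate 1%g s.
      case/conjugateP => a; rewrite mul1g -{1}[a]mulg1 => /mulgI e.
      by rewrite -e eqxx in s1.
    have l1 : word_length_le S 1%g n.
      exact: word_length_leW (word_length_le1 S).
    have ln := word_length_leW n0 sl.
    have [k ck _] := CDb n _ _ ns l1 ln.
    by exists k; apply/asboolP; exists 1%g, s.
  have vb k : `[< attained n k >] -> k <= bound n.
    move=> /asboolP[g [h [[ngh gn hn] ck]]].
    by have [k' ck' kb] := CDb n _ _ ngh gn hn; rewrite (is_CD_unique ck ck').
  case: (ex_maxnP exv vb) => N vN Nmax; exists N; split; last exact: vb.
  split; last exact/asboolP.
  move=> g h [ngh gn hn]; have [k ck _] := CDb n _ _ ngh gn hn.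
  by exists k => //; apply: Nmax; apply/asboolP; exists g, h.
have exf' n : exists N, 0 < n -> is_Conj S n N /\ N <= bound n.
  by case: (posnP n) => [->|/exf[N HN]]; [exists 0 | exists N].
have [f Hf] := choice exf'.
exists f; split; first by move=> n /Hf[].
exists (2 * B + 3) => [|n n0]; first lia.
have [_ /leq_trans] := Hf n n0; apply.
by rewrite /bound leq_exp2r ?addn1 //; nia.
Qed.

End Conj.

(** * Lower bound *)

Section LowerBound.
Variables (m : nat) (Q : finGroupType) (phi : {multiplicative heis m -> Q}).
Local Open Scope ring_scope.

Lemma heis_central_expg (n : nat) :
  heis_of 0 0 n%:Z = (heis_of 0 0 1 ^+ n)%g :> heis m.
Proof.
elim: n => [|n IH]; first by rewrite heis_of0.
by rewrite expgS -IH heis_ofM mulmx0 mxE !addr0 intS.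
Qed.

Let c : Q := phi (heis_of 0 0 1).

Lemma morph_central (n : nat) : phi (heis_of 0 0 n%:Z) = (c ^+ n)%g.
Proof.
have phi1 : phi 1%g = 1%g by apply: (mulgI (phi 1%g)); rewrite -gmulfM !mulg1.
rewrite heis_central_expg; elim: n => [|n IH]; first by rewrite phi1.
by rewrite !expgS gmulfM IH.
Qed.

(** With v a basis vector, this reads off an entry of x modulo #[c] from the
    image of (x, y, z); the next lemma does so for y. *)
Lemma morph_commutator_x (x : 'rV_m) (y v : 'cV_m) z (n : nat) :
  (x *m v) 0 0 = n%:Z ->
  (phi (heis_of x y z) * phi (heis_of 0 v 0) =
   phi (heis_of 0 v 0) * phi (heis_of x y z) * c ^+ n)%g.
Proof.
move=> e; rewrite -morph_central -!gmulfM [X in phi X = _]heis_of_mulC e.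
by rewrite mul0mx [(0 : 'M_1) _ _]mxE subr0.
Qed.

Lemma morph_commutator_y (x u : 'rV_m) (y : 'cV_m) z (n : nat) :
  (u *m y) 0 0 = n%:Z ->
  (phi (heis_of u 0 0) * phi (heis_of x y z) =
   phi (heis_of x y z) * phi (heis_of u 0 0) * c ^+ n)%g.
Proof.
move=> e; rewrite -morph_central -!gmulfM [X in phi X = _]heis_of_mulC e.
by rewrite mulmx0 [(0 : 'M_1) _ _]mxE subr0.
Qed.

(** Q has at least #[c] elements for each of the 2m + 1 coordinates, as these can
    be recovered modulo #[c] from the image of an element. *)
Lemma card_ge_order_center : (#[c]%g ^ (2 * m + 1) <= #|Q|)%N.
Proof.
pose emb (i : 'I_#[c]%g) : int := (i : nat)%:Z.
pose F (q : 'rV['I_#[c]%g]_m * 'cV['I_#[c]%g]_m * 'I_#[c]%g) :=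
  phi (heis_of (map_mx emb q.1.1) (map_mx emb q.1.2) (emb q.2)).
have cI (i j : 'I_#[c]%g) : (c ^+ i = c ^+ j)%g -> i = j.
  by move/eqP; rewrite eq_expg_mod_order !modn_small // => /eqP/val_inj.
suff /leq_card : injective F.
  rewrite !card_prod !card_mx !card_ord mul1n muln1 -expnD -expnSr.
  by rewrite addn1 mul2n addnn.
move=> [[x y] z] [[x' y'] z']; rewrite /F /= => e.
have ex : x = x'.
  apply/rowP => j; apply: cI.
  have col (w : 'rV['I_#[c]%g]_m) :
      (map_mx emb w *m (delta_mx j 0 : 'cV_m)) 0 0 = (w 0 j)%:Z.
    by rewrite -colE !mxE.
  have := morph_commutator_x (map_mx emb y) (emb z) (col x).
  by rewrite e (morph_commutator_x _ _ (col x')) => /mulgI.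
have ey : y = y'.
  apply/colP => j; apply: cI.
  have row (w : 'cV['I_#[c]%g]_m) :
      ((delta_mx 0 j : 'rV_m) *m map_mx emb w) 0 0 = (w j 0)%:Z.
    by rewrite -rowE !mxE.
  have := morph_commutator_y (map_mx emb x) (emb z) (row y).
  by rewrite e (morph_commutator_y _ _ (row y')) => /mulgI.
congr (_, _, _) => //; apply: cI; move: e; rewrite ex ey.
have central_factor (w : 'I_#[c]%g) :
    phi (heis_of (map_mx emb x') (map_mx emb y') (emb w)) =
    (phi (heis_of (map_mx emb x') (map_mx emb y') 0) * c ^+ w)%g.
  by rewrite -morph_central -gmulfM heis_ofM mulmx0 mxE !addr0 add0r.
by rewrite !central_factor => /mulgI.
Qed.

(** Otherwise gcd(2^(k+1), #[c]) divides 2^k, so that c^(2^k) is a power of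
    c^(2^(k+1)), that is, a commutator of the first element: the two images
    would be conjugate. *)
Lemma order_center_dvd (j0 : 'I_m) (k : nat) :
  ~ conjugate (phi (heis_of ((2 ^ k.+1)%N%:Z *: delta_mx 0 j0) 0 0))
              (phi (heis_of ((2 ^ k.+1)%N%:Z *: delta_mx 0 j0) 0 (2 ^ k)%N%:Z)) ->
  (2 ^ k.+1 %| #[c]%g)%N.
Proof.
move=> nconj; apply: contraT => ndvd; case: nconj.
have q0 : (0 < 2 ^ k.+1)%N by rewrite expn_gt0.
have : (gcdn (2 ^ k.+1) #[c]%g %| 2 ^ k)%N.
  have /(dvdn_pfactor _ _ (isT : prime 2))[j jk ej] :=
    dvdn_gcdl (2 ^ k.+1) #[c]%g.
  rewrite ej dvdn_exp2l // -ltnS ltn_neqAle jk andbT.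
  by apply: contraNneq ndvd => <-; rewrite -ej dvdn_gcdr.
(* By Bezout, a * r times 2^(k+1) is 2^k modulo #[c]. *)
case: (egcdnP #[c]%g q0) => a b eab _ /dvdnP[r er].
have ec : (c ^+ (2 ^ k.+1 * (a * r)) = c ^+ (2 ^ k))%g.
  apply/eqP; rewrite eq_expg_mod_order er mulnA [(_ * a)%N]mulnC eab mulnDl.
  by rewrite [(b * _ * r)%N]mulnAC modnMDl mulnC.
apply/conjugateP; exists (phi (heis_of 0 ((a * r)%N%:Z *: delta_mx j0 0) 0)).
rewrite (@morph_commutator_x _ _ _ _ (2 ^ k.+1 * (a * r))); last first.
  rewrite -scalemxAl -scalemxAr mul_delta_mx !mxE !eqxx mulr1 -PoszM //.
rewrite ec -mulgA; congr (_ * _)%g.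
by rewrite -morph_central -gmulfM heis_ofM mulmx0 mxE !addr0 add0r.
Qed.

End LowerBound.

(** The witnesses are (2^(k+1) e, 0, 0) and (2^(k+1) e, 0, 2^k), where e is a
    basis vector and 2^k <= n < 2^(k+1). *)
Lemma Conj_lower_bound (m : nat) (S : seq (heis m)) f : 0 < m -> generates S ->
  is_Conj_function S f ->
  exists2 C, 0 < C & forall n, 0 < n -> n ^ (2 * m + 1) <= f (C * n).
Proof.
move=> m0 hS hf; pose j0 : 'I_m := Ordinal m0.
have [a Xa] := generates_word_length (heis_of (delta_mx 0%R j0) 0%R 0%R) hS.
have [b Zb] := generates_word_length (heis_of 0%R 0%R 1%R) hS.
exists (2 * a + b).+1 => // n n0.
have /andP[kn nk] := trunc_log_bounds (isT : 1 < 2) n0.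
set k := trunc_log 2 n in kn nk.
pose g : heis m := heis_of ((2 ^ k.+1)%N%:Z *: delta_mx 0 j0)%R 0%R 0%R.
pose h : heis m :=
  heis_of ((2 ^ k.+1)%N%:Z *: delta_mx 0 j0)%R 0%R (2 ^ k)%N%:Z.
have eg : g = (heis_of (delta_mx 0%R j0) 0%R 0%R ^+ (2 ^ k.+1))%g.
  rewrite /g; elim: (2 ^ k.+1) => [|N IH]; first by rewrite scale0r heis_of0.
  by rewrite expgS -IH heis_ofM mulmx0 mxE !addr0 intS scalerDl scale1r.
have eh : h = (g * heis_of 0%R 0%R 1%R ^+ (2 ^ k))%g.
  by rewrite -heis_central_expg heis_ofM mulmx0 mxE !addr0 add0r.
have lg : word_length_le S g ((2 * a + b).+1 * n).
  rewrite eg; apply: word_length_leW (word_length_leX _ Xa).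
  by rewrite expnS; nia.
have lh : word_length_le S h ((2 * a + b).+1 * n).
  rewrite eh eg.
  apply: word_length_leW
    (word_length_leM (word_length_leX _ Xa) (word_length_leX _ Zb)).
  by rewrite expnS; nia.
have ngh : ~ conjugate g h.
  case/conjugate_heis_of => _ _ [u [v]].
  rewrite mulmx0 [((0 : 'M_1) 0 0)%R]mxE !subr0 -scalemxAl mxE => e.
  have : ((2 ^ k.+1)%N%:Z %| (2 ^ k)%N%:Z)%Z by rewrite e dvdz_mulr.
  rewrite dvdzE /=.
  by rewrite dvdn_Pexp2l // ltnn.
have [N [[[Q [phi [sphi nc eQ]]] _] Nf]] :
    exists N, is_CD g h N /\ N <= f ((2 * a + b).+1 * n).
  have Cn0 : 0 < (2 * a + b).+1 * n by rewrite muln_gt0.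
  by have [/(_ g h)[//|N ? ?] _] := hf _ Cn0; exists N.
apply: leq_trans Nf; rewrite -eQ.
apply: leq_trans (card_ge_order_center phi).
have /dvdn_leq := order_center_dvd nc.
rewrite order_gt0 => /(_ isT) H.
by rewrite leq_exp2r ?addn1 // (leq_trans (ltnW nk)).
Qed.

Theorem theorem1p6 (m : nat) (hm : 1 <= m) (S : seq (heis m))
    (hS : generates S) :
  exists f : nat -> nat,
    is_Conj_function S f /\ growth_eq f (fun n => n ^ (2 * m + 1)).
Proof.
have [f [hf [C C0 HC]]] := Conj_upper_bound hS.
have [D D0 HD] := Conj_lower_bound hm hS hf.
exists f; split=> //; split; [exists C|exists D] => // n n0.
  by apply: leq_trans (HC n n0) _; rewrite leq_pmull.
by apply: leq_trans (HD n n0) _; rewrite leq_pmull.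
Qed.
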